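(* Let $M$ be a matroid with no loops and let $\leq$ be a linear order on $E(M)$. The following statements are equivalent: (1) $\leq$ has the cyclic interval property; (2) for every minor $N$ of $M$ that has neither loops nor coloops, each circuit-hyperplane of $N$ is a cyclic interval in the linear order that $\leq$ induces on $E(N)$; (3) for every minor $N$ of $M$ for which $E(N)$ is the disjoint union of a $2$-element circuit $C$ and a $2$-element cocircuit, the circuit $C$ is a cyclic interval in the linear order that $\leq$ induces on $E(N)$.
   Context: A cyclic interval of a linear order $\leq$ on a set $E$ is a set $A\subseteq E$ such that $A$ or $E-A$ is an interval of $\leq$. A set $X$ of a matroid is connected if $M|X$ is connected. For a matroid $M$ with no loops, a linear order on $E(M)$ has the cyclic interval property if, for each proper connected flat $F$ of $M$ with $|F|\geq 2$ and each connected component $K$ of the contraction $M/F$ with $|E(K)|\geq 2$, the set $E(K)$ is a subset of a cyclic interval that is disjoint from $F$. *)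

(* Defs.v *)
From mathcomp Require Import all_boot.

Set Implicit Arguments.
Unset Strict Implicit.
Unset Printing Implicit Defensive.

(* All matroids are finite. Ground sets are subsets of a fixed finite type, so *)
(* that a matroid and all of its minors have the same Rocq type.               *)
Record matroid (T : finType) := Matroid {
  ground : {set T};
  indeps : {set {set T}};
  indeps_ground : forall I, I \in indeps -> I \subset ground;
  indeps0 : set0 \in indeps;
  indepsS : forall I J : {set T}, I \subset J -> J \in indeps -> I \in indeps;
  indeps_aug : forall I J : {set T}, I \in indeps -> J \in indeps ->
    #|I| < #|J| -> exists2 e, e \in J :\: I & e |: I \in indeps
}.

Section Matroid.

Variables (T : finType) (M : matroid T).
Implicit Types (A B C D F H I J X K : {set T}) (e f : T).

Definition basis B : bool := maxset (fun I => I \in indeps M) B.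

Definition circuit C : bool :=
  minset (fun D => (D \subset ground M) && (D \notin indeps M)) C.

Definition rank X : nat := \max_(I in indeps M | I \subset X) #|I|.

Definition cl X : {set T} := [set e in ground M | rank (e |: X) == rank X].

Definition flat F : bool := (F \subset ground M) && (cl F == F).

Definition hyperplane H : bool := flat H && ((rank H).+1 == rank (ground M)).

Definition circuit_hyperplane X : bool := circuit X && hyperplane X.

Definition loop e : bool := circuit [set e].

Definition loopless : Prop := forall e, ~~ loop e.

Definition same_component e f : bool :=
  (e == f) || [exists C : {set T}, circuit C && ([set e; f] \subset C)].

(* Ground set of a connected component.  [same_component] is an equivalence    *)
(* relation on the ground set, and the components are its classes.             *)
Definition component K : Prop :=
  exists2 e, e \in ground M & K = [set f in ground M | same_component e f].

Definition connected : Prop := {in ground M &, forall e f, same_component e f}.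

Fact restrict_ground_subproof X I :
  I \in [set I in indeps M | I \subset X] -> I \subset ground M :&: X.
Proof. by rewrite inE subsetI => /andP[/indeps_ground-> ->]. Qed.

Fact restrict0_subproof X : set0 \in [set I in indeps M | I \subset X].
Proof. by rewrite inE indeps0 sub0set. Qed.

Fact restrictS_subproof X I J : I \subset J ->
  J \in [set I in indeps M | I \subset X] ->
  I \in [set I in indeps M | I \subset X].
Proof.
move=> sIJ; rewrite !inE => /andP[iJ sJX].
by rewrite (indepsS sIJ iJ) (subset_trans sIJ sJX).
Qed.

Fact restrict_aug_subproof X I J :
  I \in [set I in indeps M | I \subset X] ->
  J \in [set I in indeps M | I \subset X] ->
  #|I| < #|J| ->
  exists2 e, e \in J :\: I & e |: I \in [set I in indeps M | I \subset X].
Proof.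
rewrite !inE => /andP[iI sIX] /andP[iJ sJX] ltIJ.
have [e eJI ieI] := indeps_aug iI iJ ltIJ; exists e => //.
rewrite inE ieI subUset sub1set sIX andbT /=.
by case/setDP: eJI => eJ _; apply: (subsetP sJX).
Qed.

Definition restrict X : matroid T :=
  @Matroid T (ground M :&: X) [set I in indeps M | I \subset X]
    (@restrict_ground_subproof X) (restrict0_subproof X)
    (@restrictS_subproof X) (@restrict_aug_subproof X).

Definition delete X : matroid T := restrict (ground M :\: X).

(* Independent sets of the dual, whose bases are the complements of the bases. *)
Definition coindeps : {set {set T}} :=
  [set I : {set T} | [exists B, basis B && (I \subset ground M :\: B)]].

Fact dual_ground_subproof I : I \in coindeps -> I \subset ground M.
Proof.
by rewrite inE => /existsP[B /andP[_ /subset_trans]]; apply; apply: subsetDl.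
Qed.

Fact dual0_subproof : set0 \in coindeps.
Proof.
have [B mB _] := @maxset_exists _ (fun I => I \in indeps M) _ (indeps0 M).
by rewrite inE; apply/existsP; exists B; rewrite sub0set andbT.
Qed.

Fact dualS_subproof I J : I \subset J -> J \in coindeps -> I \in coindeps.
Proof.
move=> sIJ; rewrite !inE => /existsP[B /andP[bB sJ]].
by apply/existsP; exists B; rewrite bB (subset_trans sIJ sJ).
Qed.

Fact basis_indep B : basis B -> B \in indeps M.
Proof. by case/maxsetP. Qed.

Fact indep_card_basis I B : I \in indeps M -> basis B -> #|I| <= #|B|.
Proof.
move=> iI /maxsetP[iB maxB]; rewrite leqNgt; apply/negP => ltBI.
have [e /setDP[_ eB] ieB] := indeps_aug iB iI ltBI.
by case/negP: eB; rewrite -(maxB _ ieB (subsetUr _ _)) setU11.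
Qed.

Fact basis_of_card I B : I \in indeps M -> basis B -> #|B| <= #|I| -> basis I.
Proof.
move=> iI bB leBI; apply/maxsetP; split=> // J iJ sIJ; apply/esym/eqP.
by rewrite eqEcard sIJ (leq_trans (indep_card_basis iJ bB)).
Qed.

Fact basis_extend I B : I \in indeps M -> basis B ->
  exists2 B', basis B' & (I \subset B') && (B' \subset I :|: B).
Proof.
move=> iI bB.
pose P J := (J \in indeps M) && (J \subset I :|: B).
have PI : P I by rewrite /P iI subsetUl.
have [J /maxsetP[/andP[iJ sJ] maxJ] sIJ] := maxset_exists PI.
exists J; last by rewrite sIJ sJ.
apply: (basis_of_card iJ bB); rewrite leqNgt; apply/negP => ltJB.
have [e /setDP[eB eJ] ieJ] := indeps_aug iJ (basis_indep bB) ltJB.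
case/negP: eJ; rewrite -(maxJ (e |: J)) ?setU11 ?subsetUr //.
by rewrite /P ieJ subUset sub1set inE eB orbT sJ.
Qed.

Fact dual_aug_subproof I J : I \in coindeps -> J \in coindeps -> #|I| < #|J| ->
  exists2 e, e \in J :\: I & e |: I \in coindeps.
Proof.
move=> cI cJ ltIJ.
have sIE := dual_ground_subproof cI; have sJE := dual_ground_subproof cJ.
move: cI cJ; rewrite !inE => /existsP[B /andP[bB]].
rewrite subsetD disjoint_sym => /andP[_ dBI] /existsP[B' /andP[bB']].
rewrite subsetD => /andP[_ dJB'].
have iB'I : B' :\: I \in indeps M by apply: indepsS (basis_indep bB'); apply: subsetDl.
have [B2 bB2 /andP[sB2 B2s]] := basis_extend iB'I bB.
have dB2I : [disjoint I & B2].
  rewrite disjoint_sym; apply: disjointWl B2s _.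
  rewrite -setI_eq0 setIUl setU_eq0 !setI_eq0 dBI andbT.
  by rewrite -setI_eq0 setIDAC -setIDA setDv setI0.
have [|] := boolP [exists e in J :\: I, e \notin B2].
  case/existsP=> e /andP[eJI eB2]; exists e => //.
  rewrite inE; apply/existsP; exists B2; rewrite bB2 /= subsetD.
  case/setDP: eJI => eJ _.
  rewrite subUset sub1set (subsetP sJE _ eJ) sIE /=.
  by rewrite -setI_eq0 setIUl setU_eq0 !setI_eq0 dB2I disjoints1 eB2.
rewrite negb_exists => /forallP noe.
have sJIB2 : J :\: I \subset B2.
  by apply/subsetP=> e eJI; move: (noe e); rewrite eJI negbK.
have dd : [disjoint J :\: I & B' :\: I].
  by apply: disjointWl (subsetDl _ _) _; apply: disjointWr (subsetDl _ _) _.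
have le1 : #|J :\: I| + #|B' :\: I| <= #|B2|.
  rewrite -(leq_add2r #|(J :\: I) :&: (B' :\: I)|) -cardsUI.
  move: dd; rewrite -setI_eq0 => /eqP->; rewrite cards0 !addn0.
  by apply: subset_leq_card; rewrite subUset sJIB2.
have le2 : #|B' :&: I| <= #|I :\: J|.
  apply: subset_leq_card; apply/subsetP=> x /setIP[xB' xI]; rewrite inE xI andbT.
  by apply/negP=> xJ; rewrite (disjointFr dJB' xJ) in xB'.
have := leq_trans le1 (indep_card_basis (basis_indep bB2) bB').
rewrite -(cardsID I B') leq_add2r leqNgt (leq_ltn_trans le2) //.
by rewrite -(ltn_add2l #|I :&: J|) cardsID setIC cardsID.
Qed.

Definition dual_matroid : matroid T :=
  @Matroid T (ground M) coindeps dual_ground_subproof dual0_subproof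
    dualS_subproof dual_aug_subproof.

End Matroid.

Section Minors.

Variables (T : finType).
Implicit Types (M N : matroid T) (X Y C D F K : {set T}) (e : T).

Definition connected_set M X : Prop := connected (restrict M X).

Definition coloop M e : bool := loop (dual_matroid M) e.

Definition coloopless M : Prop := forall e, ~~ coloop M e.

Definition cocircuit M D : bool := circuit (dual_matroid M) D.

Definition contract M X : matroid T :=
  dual_matroid (delete (dual_matroid M) X).

Definition minor N M : Prop := exists X Y : {set T},
  [/\ X \subset ground M, Y \subset ground M, [disjoint X & Y]
    & N = contract (delete M X) Y].

End Minors.

Section CyclicIntervals.

Variables (T : finType).
Implicit Types (E A F K : {set T}) (le : rel T).

(* Only the values of [le] on E matter.  The order that it induces on a subset *)
(* E' of E is given by the same relation, considered on E'.                    *)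
Definition linear_order_on E le : Prop :=
  [/\ {in E, reflexive le}, {in E &, antisymmetric le},
      {in E & &, transitive le} & {in E &, total le}].

Definition is_interval E le A : Prop :=
  A \subset E /\
  forall a b c, a \in A -> b \in A -> c \in E -> le a c -> le c b -> c \in A.

Definition cyclic_interval E le A : Prop :=
  A \subset E /\ (is_interval E le A \/ is_interval E le (E :\: A)).

Definition cyclic_interval_property (M : matroid T) le : Prop :=
  forall F, flat M F -> connected_set M F -> F \proper ground M -> 2 <= #|F| ->
  forall K, component (contract M F) K -> 2 <= #|K| ->
  exists A, [/\ cyclic_interval (ground M) le A, K \subset A & [disjoint A & F]].

End CyclicIntervals.

(* Main.v *)
(** Suppose (3) holds. If no elements f1, f2 of F cross two elements k1, k2 of
K in the cyclic order, then K lies in one gap of F. A circuit of M|F through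
f1, f2 and a circuit of M/F through k1, k2 yield a minor on {f1, f2, k1, k2}
in which {f1, f2} is a circuit and {k1, k2} a cocircuit, so (3) rules out any
crossing, whence (1).

Suppose (1) holds and X is a circuit-hyperplane of N = M\U/Y. Some circuit C of
M satisfies X <= C <= X u Y, so X lies in one component F of M|H, where
H = cl(X u Y); F is a connected flat. For d, e in E(N) - X, each of d, e and
{d, e} raises the rank of H by exactly one, hence some circuit of M/F contains
both, and E(N) - X lies in one component of M/F. The cyclic interval given by
(1) then separates X from E(N) - X. *)
Require Import Defs.
From mathcomp Require Import all_boot zify.

Set Implicit Arguments.
Unset Strict Implicit.
Unset Printing Implicit Defensive.

(** * Rank function, circuits and circuit elimination *)

Section Rank.

Variables (T : finType) (M : matroid T).
Implicit Types (A B C D F H I J X Y S : {set T}) (e f : T).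

Lemma leq_rank I X : I \in indeps M -> I \subset X -> #|I| <= rank M X.
Proof.
by move=> iI sIX; rewrite /rank; apply: leq_bigmax_cond; rewrite iI sIX.
Qed.

Lemma rank_basis I X : I \in indeps M -> I \subset X ->
  exists J, [/\ J \in indeps M, I \subset J, J \subset X & #|J| = rank M X].
Proof.
move=> iI sIX; pose P J := (J \in indeps M) && (J \subset X).
have PI : P I by rewrite /P iI.
have [J /maxsetP[/andP[iJ sJX] maxJ] sIJ] := maxset_exists PI.
exists J; split=> //; apply/eqP; rewrite eqn_leq leq_rank //=.
apply/bigmax_leqP=> L /andP[iL sLX]; rewrite leqNgt; apply/negP => ltJL.
have [e /setDP[eL eJ] ieJ] := indeps_aug iJ iL ltJL.
case/negP: eJ; rewrite -(maxJ (e |: J)) ?setU11 ?subsetUr //.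
by rewrite /P ieJ subUset sub1set sJX (subsetP sLX).
Qed.

Lemma rank_witness X :
  exists J, [/\ J \in indeps M, J \subset X & #|J| = rank M X].
Proof.
by have [J []] := rank_basis (indeps0 M) (sub0set X); exists J.
Qed.

Lemma rankS X Y : X \subset Y -> rank M X <= rank M Y.
Proof.
move=> sXY; have [J [iJ sJX <-]] := rank_witness X.
exact: leq_rank iJ (subset_trans sJX sXY).
Qed.

Lemma rank_leq_card X : rank M X <= #|X|.
Proof. by have [J [_ sJX <-]] := rank_witness X; apply: subset_leq_card. Qed.

Lemma indep_rank I : (I \in indeps M) = (rank M I == #|I|).
Proof.
apply/idP/eqP=> [iI|rI].
  by apply/eqP; rewrite eqn_leq rank_leq_card leq_rank.
have [J [iJ sJI cJ]] := rank_witness I.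
suff <- : J = I by [].
by apply/eqP; rewrite eqEcard sJI cJ rI leqnn.
Qed.

(** Extend a basis [J] of the intersection to a basis [L] of the union. The traces of [L] on [X] and
    [Y] are independent, cover [L], and overlap in a set containing [J]. *)
Lemma rank_submod X Y :
  rank M (X :|: Y) + rank M (X :&: Y) <= rank M X + rank M Y.
Proof.
have [J [iJ sJ <-]] := rank_witness (X :&: Y).
have sJU : J \subset X :|: Y.
  apply: subset_trans sJ _.
  exact: subset_trans (subsetIl _ _) (subsetUl _ _).
have [L [iL sJL sL <-]] := rank_basis iJ sJU.
have rX : #|L :&: X| <= rank M X.
  by apply: leq_rank (subsetIr _ _); apply: indepsS (subsetIl _ _) iL.
have rY : #|L :&: Y| <= rank M Y.
  by apply: leq_rank (subsetIr _ _); apply: indepsS (subsetIl _ _) iL.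
apply: leq_trans (leq_add rX rY); rewrite -(cardsUI (L :&: X)) -setIUr.
rewrite (setIidPl sL) leq_add2l -setIIr; apply: subset_leq_card.
by rewrite subsetI sJL.
Qed.

(** Submodularity for [F] and [J :|: S]: their intersection contains [J], so it already has the rank
    of [F]. This is the tool for replacing a set by a basis or by its closure inside a larger
    union. *)
Lemma rank_spanU F J S : J \subset F -> rank M J = rank M F ->
  rank M (J :|: S) = rank M (F :|: S).
Proof.
move=> sJF rJ; apply/eqP; rewrite eqn_leq rankS ?setSU //=.
have := rank_submod F (J :|: S).
rewrite setUA (setUidPl sJF) => le1.
have : rank M J <= rank M (F :&: (J :|: S)).
  by apply: rankS; rewrite subsetI sJF subsetUl.
lia.
Qed.

Lemma rankU_leq X Y : rank M (X :|: Y) <= rank M X + #|Y|.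
Proof. by have := rank_submod X Y; have := rank_leq_card Y; lia. Qed.

Lemma rankU1_leq e X : rank M (e |: X) <= (rank M X).+1.
Proof. by have := rankU_leq X [set e]; rewrite setUC cards1 addn1. Qed.

Lemma basis_rank B :
  basis M B = (B \in indeps M) && (#|B| == rank M (ground M)).
Proof.
have [J [iJ sJ cJ]] := rank_witness (ground M).
apply/idP/andP=> [bB|[iB /eqP cB]].
  have iB := basis_indep bB; split=> //.
  by rewrite eqn_leq leq_rank ?indeps_ground //= -cJ (indep_card_basis iJ bB).
apply/maxsetP; split=> // L iL sBL; apply/esym/eqP.
by rewrite eqEcard sBL cB leq_rank ?indeps_ground.
Qed.

(** Ranks in minors and duals are computed from [rank M], so a description of circuits by rank alone
    can be carried from one matroid to another. The last clause expresses minimality: every [C :\ e]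
    has full rank and is therefore independent. *)
Lemma circuitP C :
  reflect [/\ C \subset ground M, (rank M C).+1 = #|C|
            & {in C, forall e, rank M (C :\ e) = rank M C}]
          (circuit M C).
Proof.
apply: (iffP minsetP) => [[/andP[sC dC] minC] | [sC rC rCe]].
  have rD e : e \in C -> rank M (C :\ e) = #|C :\ e|.
    move=> eC; apply/eqP; rewrite -indep_rank; apply/negPn/negP=> dCe.
    have E := minC (C :\ e); move: eC; rewrite -E ?subD1set ?setD11 //.
    by rewrite dCe (subset_trans (subD1set _ _)).
  have rC : (rank M C).+1 = #|C|.
    have [e eC] : exists e, e \in C.
      by apply/set0Pn; apply: contraNneq dC => ->; apply: indeps0.
    have := rD e eC; have := rankS (subD1set C e); have := rank_leq_card C.
    by move: dC; rewrite indep_rank (cardsD1 e C) eC; lia.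
  split=> // e eC; rewrite rD //; have := cardsD1 e C; rewrite eC; lia.
split; first by rewrite sC indep_rank; apply/eqP; lia.
move=> B /andP[sB dB] sBC; apply/eqP; rewrite eqEsubset sBC /=.
apply/subsetP=> e eC; apply: contraNT dB => eB.
have iCe : C :\ e \in indeps M.
  by rewrite indep_rank rCe //; have := cardsD1 e C; rewrite eC; lia.
by apply: indepsS iCe; rewrite subsetD1 sBC.
Qed.

Lemma dep_circuit D : D \subset ground M -> D \notin indeps M ->
  exists2 C, circuit M C & C \subset D.
Proof.
move=> sD dD; pose P D := (D \subset ground M) && (D \notin indeps M).
have PD : P D by rewrite /P sD.
by have [C cC sC] := minset_exists PD; exists C.
Qed.

Lemma circuit_dep C : circuit M C -> C \notin indeps M.
Proof. by case/circuitP=> _ rC _; rewrite indep_rank; apply/eqP; lia. Qed.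

Lemma circuit_sub C D : circuit M C -> circuit M D -> C \subset D -> C = D.
Proof. by move=> /minsetP[pC _] /minsetP[_ /(_ C pC)]. Qed.

(** For a basis [J] of [X], the set [e |: J] is dependent, and a circuit in it must use [e] because
    [J] is independent. *)
Lemma circuit_through e X : e \in ground M -> e \notin X ->
  rank M (e |: X) = rank M X ->
  exists C, [/\ circuit M C, e \in C & C \subset e |: X].
Proof.
move=> eE eX rX; have [J [iJ sJ cJ]] := rank_witness X.
have [||C cC sC] := @dep_circuit (e |: J).
- by rewrite subUset sub1set eE indeps_ground.
- rewrite indep_rank; apply/eqP.
  have := rankS (setUS [set e] sJ); rewrite cardsU1.
  by rewrite (contraNN (subsetP sJ e) eX) /= ; lia.
exists C; split=> //; last by apply: subset_trans sC (setUS _ sJ).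
apply: contraNT (circuit_dep cC) => eC; apply: indepsS iJ.
apply/subsetP=> x xC; have := subsetP sC x xC; rewrite !inE.
by case: eqP => // xe; rewrite -xe xC in eC.
Qed.

Lemma circuit_cl C e X : circuit M C -> e \in C -> C :\ e \subset X ->
  rank M (e |: X) = rank M X.
Proof.
case/circuitP=> _ _ rC eC sX; have := rank_spanU X (subD1set C e) (rC e eC).
rewrite (setUidPr sX) => ->; congr rank; apply/setP=> x.
rewrite !inE; case: eqP => [->|/eqP ne]; rewrite ?eC //=.
case xC: (x \in C) => //=; apply: (subsetP sX).
by rewrite !inE ne.
Qed.

(** Strong elimination by closure. With [W] the union without [e] and [f], the circuit [C2] shows
    that [W] spans [f], and [C1] shows that [f |: W] spans [e]. So [W] spans [e], and some circuit
    through [e] lies in [e |: W]. *)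
Lemma circuit_elim C1 C2 e f : circuit M C1 -> circuit M C2 ->
  f \in C1 -> f \in C2 -> e \in C1 -> e \notin C2 ->
  exists C, [/\ circuit M C, e \in C & C \subset (C1 :|: C2) :\ f].
Proof.
move=> c1 c2 f1 f2 e1 e2; pose W := (C1 :|: C2) :\ f :\ e.
have ef : e != f by apply: contraNneq e2 => ->.
have r2 : rank M (f |: W) = rank M W.
  apply: circuit_cl c2 f2 _; apply/subsetP=> x; rewrite !inE => /andP[-> x2].
  by rewrite x2 orbT !andbT; apply: contraNneq e2 => <-.
have r1 : rank M (e |: (f |: W)) = rank M (f |: W).
  apply: circuit_cl c1 e1 _; apply/subsetP=> x; rewrite !inE => /andP[-> ->].
  by rewrite /= andbT orbN.
have rW : rank M (e |: W) = rank M W.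
  apply/eqP; rewrite eqn_leq (rankS (subsetUr _ _)) andbT -r2 -r1.
  by apply: rankS; rewrite setUS ?subsetUr.
have eE : e \in ground M by case/circuitP: c1 => /subsetP/(_ e e1).
have [|C [cC eC sC]] := circuit_through eE _ rW; first by rewrite !inE eqxx.
exists C; split=> //; apply: subset_trans sC _.
by rewrite subUset sub1set !inE ef e1 subD1set.
Qed.

(* If the two circuits obtained by eliminating [f], one through [a] and one
through [c], do not give smaller unions with [C2] and [C1], they meet each other
and their union avoids [f]. *)
Lemma circuit_meet C1 C2 a c : circuit M C1 -> circuit M C2 ->
  a \in C1 -> c \in C2 -> C1 :&: C2 != set0 ->
  exists C, [/\ circuit M C, a \in C & c \in C].
Proof.
have [n] := ubnP #|C1 :|: C2|; elim: n C1 C2 => // n IHn C1 C2 /ltnSE len.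
move=> cC1 cC2 aC1 cC2' /set0Pn[f /setIP[f1 f2]].
have IH D1 D2 : D1 :|: D2 \proper C1 :|: C2 -> circuit M D1 -> circuit M D2 ->
    a \in D1 -> c \in D2 -> D1 :&: D2 != set0 ->
    exists C, [/\ circuit M C, a \in C & c \in C].
  by move=> /proper_card lt; apply: IHn; apply: leq_trans lt len.
have [c1|c1] := boolP (c \in C1); first by exists C1.
have [a2|a2] := boolP (a \in C2); first by exists C2.
have [C3 [cC3 aC3 s3]] := circuit_elim cC1 cC2 f1 f2 aC1 a2.
have [C4 [cC4 cC4' s4]] := circuit_elim cC2 cC1 f2 f1 cC2' c1.
rewrite (setUC C2) in s4.
have [s3' f3] : C3 \subset C1 :|: C2 /\ f \notin C3.
  by apply/andP; rewrite -subsetD1.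
have [s4' f4] : C4 \subset C1 :|: C2 /\ f \notin C4.
  by apply/andP; rewrite -subsetD1.
have [x x3 x1] : exists2 x, x \in C3 & x \notin C1.
  apply/subsetPn; apply: contra f3 => s31; by rewrite (circuit_sub cC3 cC1 s31).
have x2 : x \in C2.
  by have := subsetP s3' x x3; rewrite inE (negPf x1).
have [y y4 y2] : exists2 y, y \in C4 & y \notin C2.
  apply/subsetPn; apply: contra f4 => s; by rewrite (circuit_sub cC4 cC2 s).
have y1 : y \in C1.
  by have := subsetP s4' y y4; rewrite inE (negPf y2) orbF.
have [x4|x4] := boolP (x \in C4).
  apply: (IH C3 C4) => //; last by apply/set0Pn; exists x; rewrite inE x3.
  apply/properP; split; first by rewrite subUset s3'.
  by exists f; rewrite !inE ?f1 // negb_or f3.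
apply: (IH C1 C4) => //; last by apply/set0Pn; exists y; rewrite inE y1.
apply/properP; split; first by rewrite subUset s4' subsetUl.
by exists x; rewrite !inE ?x2 ?orbT // negb_or x1.
Qed.

(** * Connected components as equivalence classes *)

Lemma same_component_refl e : same_component M e e.
Proof. by rewrite /same_component eqxx. Qed.

Lemma circuit_same_component C e f : circuit M C -> e \in C -> f \in C ->
  same_component M e f.
Proof.
move=> cC eC fC; apply/orP; right; apply/existsP; exists C.
by rewrite cC subUset !sub1set eC.
Qed.

Lemma same_componentP e f : e != f -> same_component M e f ->
  exists C, [/\ circuit M C, e \in C & f \in C].
Proof.
move=> /negPf ef; rewrite /same_component ef /= => /existsP[C /andP[cC]].
by rewrite subUset !sub1set => /andP[]; exists C.
Qed.

Lemma same_component_sym e f : same_component M e f = same_component M f e.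
Proof. by rewrite /same_component eq_sym setUC. Qed.

Lemma same_component_trans e f g :
  same_component M e f -> same_component M f g -> same_component M e g.
Proof.
have [->//|ef] := eqVneq e f; have [->//|fg] := eqVneq f g.
move=> /(same_componentP ef)[C [cC eC fC]] /(same_componentP fg)[D [cD fD gD]].
have [|L [cL eL gL]] := circuit_meet cC cD eC gD.
  by apply/set0Pn; exists f; rewrite inE fC.
exact: circuit_same_component cL eL gL.
Qed.

(** Since [e |: S] spans [f], a circuit through [f] lies in [f |: (e |: S)]. If it missed [e], then
    [S] alone would span [f], against the rank hypothesis on [f]. *)
Lemma rank_same_component e f S : e \in ground M -> f \in ground M ->
  rank M S < rank M (e |: S) -> rank M S < rank M (f |: S) ->
  rank M (f |: (e |: S)) = rank M (e |: S) -> same_component M e f.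
Proof.
move=> eE fE re rf ref; have [->|ef] := eqVneq e f.
  exact: same_component_refl.
have fS : f \notin S.
  by apply: contraTN rf => fS; rewrite (setUidPr _) ?sub1set // ltnn.
have [|C [cC fC sC]] := circuit_through fE _ ref.
  by rewrite !inE eq_sym negb_or ef.
apply: (circuit_same_component cC _ fC); apply: contraTT rf => eC.
rewrite -leqNgt (circuit_cl cC fC) //; apply/subsetP=> x.
rewrite !inE => /andP[xf xC]; have := subsetP sC x xC.
rewrite !inE (negPf xf) /= => /orP[/eqP xe|//].
by rewrite -xe xC in eC.
Qed.

(** * Closure *)

Lemma in_cl e X :
  (e \in cl M X) = (e \in ground M) && (rank M (e |: X) == rank M X).
Proof. by rewrite inE. Qed.

Lemma sub_cl X : X \subset ground M -> X \subset cl M X.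
Proof.
move=> sX; apply/subsetP=> x xX; rewrite in_cl (subsetP sX) //.
by rewrite (setUidPr _) ?sub1set ?eqxx.
Qed.

(** It suffices that [cl M X] has the rank of [X]. Extend a basis [J] of [X] to a basis [L] of the
    closure: an element [x] of [L] outside [J] would make [x |: J] independent, although [x |: X]
    has rank only [#|J|]. *)
Lemma rank_clU X S : X \subset ground M ->
  rank M (cl M X :|: S) = rank M (X :|: S).
Proof.
move=> sX; apply/esym; apply: rank_spanU; first exact: sub_cl.
have [J [iJ sJ cJ]] := rank_witness X.
have [L [iL sJL sL cL]] := rank_basis iJ (subset_trans sJ (sub_cl sX)).
suff -> : rank M (cl M X) = #|J| by [].
rewrite -cL; suff -> : L = J by [].
apply/eqP; rewrite eqEsubset sJL andbT; apply/subsetP=> x xL.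
apply/negPn/negP=> xJ; have := subsetP sL x xL.
rewrite in_cl => /andP[_ /eqP rx].
have : #|x |: J| <= rank M (x |: X).
  apply: leq_rank (setUS _ sJ).
  by apply: indepsS iL; rewrite subUset sub1set xL.
by rewrite cardsU1 xJ rx -cJ ltnn.
Qed.

Lemma cl_ground X : cl M X \subset ground M.
Proof. by apply/subsetP=> x; rewrite in_cl => /andP[]. Qed.

End Rank.

(** * Ranks in restrictions, duals, contractions and minors *)

Section MinorRank.

Variables (T : finType).
Implicit Types (M N : matroid T) (A B C D F H I J X Y Z U : {set T}) (e f : T).

Lemma rank_restrict M X Z : rank (restrict M X) Z = rank M (Z :&: X).
Proof.
apply/eqP; rewrite eqn_leq; apply/andP; split.
  have [J [+ sJ <-]] := rank_witness (restrict M X) Z.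
  rewrite inE => /andP[iJ sJX].
  by apply: leq_rank => //; rewrite subsetI sJ.
have [J [iJ + <-]] := rank_witness M (Z :&: X).
rewrite subsetI => /andP[sJZ sJX].
by apply: leq_rank => //; rewrite inE iJ.
Qed.

Lemma circuit_restrict M X C :
  circuit (restrict M X) C = (C \subset X) && circuit M C.
Proof.
have rI (S : {set T}) : S \subset X -> S :&: X = S by move/setIidPl.
apply/circuitP/idP => [[]|/andP[sX /circuitP[sC rC rCe]]].
  rewrite /= subsetI => /andP[sC sX] rC rCe; rewrite sX /=.
  move: rC; rewrite rank_restrict rI // => rC.
  apply/circuitP; split=> // e eC; have := rCe e eC.
  by rewrite !rank_restrict !rI // (subset_trans (subD1set _ _)).
split; first by rewrite /= subsetI sC.
  by rewrite rank_restrict rI.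
by move=> e /rCe; rewrite !rank_restrict !rI // (subset_trans (subD1set _ _)).
Qed.

(** A coindependent subset of [X] avoids a basis [B], and [B :\: X] is independent outside [X];
    counting gives one inequality. For the other, extend a basis of the complement of [X] to a basis
    of [M]: the rest of [X] is coindependent. *)
Lemma rank_dual M X : X \subset ground M ->
  rank (dual_matroid M) X + rank M (ground M) = #|X| + rank M (ground M :\: X).
Proof.
move=> sX; apply/eqP; rewrite eqn_leq; apply/andP; split.
  have [I [+ sI <-]] := rank_witness (dual_matroid M) X.
  rewrite inE => /existsP[B]; rewrite basis_rank.
  case/andP=> /andP[iB /eqP <-] sIB.
  have le1 : #|B :\: X| <= rank M (ground M :\: X).
    apply: leq_rank; last by rewrite setSD ?indeps_ground.
    by apply: indepsS iB; apply: subsetDl.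
  have le2 : #|I| <= #|X :\: B|.
    apply: subset_leq_card; move: sIB; rewrite !subsetD => /andP[_ ->].
    by rewrite sI.
  have := cardsID X B; have := cardsID B X; rewrite (setIC X B); lia.
have [J [iJ sJ cJ]] := rank_witness M (ground M :\: X).
have [B [iB sJB _ cB]] := rank_basis iJ (subset_trans sJ (subsetDl _ _)).
have le1 : #|X :\: B| <= rank (dual_matroid M) X.
  apply: leq_rank (subsetDl _ _); rewrite inE; apply/existsP; exists B.
  by rewrite basis_rank iB cB eqxx setSD.
have le2 : #|J| <= #|B :\: X|.
  apply: subset_leq_card; move: sJ; rewrite !subsetD => /andP[_ ->].
  by rewrite sJB.
have := cardsID X B; have := cardsID B X; rewrite (setIC X B); lia.
Qed.

(** Contraction is defined by deleting in the dual, so the dual rank formula is applied twice. The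
    identity is stated with sums because subtraction on naturals truncates. *)
Lemma rank_contract M X Z : X \subset ground M -> Z \subset ground M :\: X ->
  rank (contract M X) Z + rank M X = rank M (Z :|: X).
Proof.
move=> sX sZ; pose N := delete (dual_matroid M) X.
have gN : ground N = ground M :\: X.
  by rewrite /N /= (setIidPr (subsetDl _ _)).
have E1 : rank (contract M X) Z + rank N (ground N) =
    #|Z| + rank N (ground N :\: Z) by apply: rank_dual; rewrite gN.
have rN (S : {set T}) : S \subset ground M :\: X ->
    rank N S + rank M (ground M) = #|S| + rank M (ground M :\: S).
  move=> sS; rewrite rank_restrict (setIidPl sS) rank_dual //.
  exact: subset_trans sS (subsetDl _ _).
have := rN _ (subxx _); have := rN (ground M :\: X :\: Z) (subsetDl _ _).
rewrite !gN in E1 *; rewrite setDDl.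
have -> : ground M :\: (ground M :\: X) = X.
  by rewrite setDDr setDv set0U; apply/setIidPr.
have sXZ : X :|: Z \subset ground M.
  by rewrite subUset sX (subset_trans sZ) ?subsetDl.
have -> : ground M :\: (ground M :\: (X :|: Z)) = Z :|: X.
  by rewrite setDDr setDv set0U setUC; apply/setIidPr; rewrite setUC.
have := cardsID Z (ground M :\: X); rewrite (setIidPr sZ) setDDl.
rewrite setDDl in E1; lia.
Qed.

Lemma ground_contract M X : ground (contract M X) = ground M :\: X.
Proof. by rewrite /= (setIidPr (subsetDl _ _)). Qed.

Lemma ground_minor M X Y :
  ground (contract (delete M X) Y) = ground M :\: (X :|: Y).
Proof. by rewrite ground_contract /= (setIidPr (subsetDl _ _)) setDDl. Qed.

Lemma rank_minor M X Y Z : Y \subset ground M -> [disjoint X & Y] ->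
  Z \subset ground M :\: (X :|: Y) ->
  rank (contract (delete M X) Y) Z + rank M Y = rank M (Z :|: Y).
Proof.
move=> sY dXY sZ.
have gD : ground (delete M X) = ground M :\: X.
  by rewrite /= (setIidPr (subsetDl _ _)).
have sYD : Y \subset ground M :\: X by rewrite subsetD sY disjoint_sym.
have sZD : Z \subset ground M :\: X.
  by apply: subset_trans sZ _; rewrite setDS // subsetUl.
have := @rank_contract (delete M X) Y Z; rewrite gD setDDl => /(_ sYD sZ).
by rewrite !rank_restrict !(setIidPl _) ?subUset ?sZD.
Qed.

(** Cocircuits as complements of hyperplanes: the complement does not span, but any further element
    makes it span. Both directions translate the rank description of circuits through the dual rank
    formula. *)
Lemma cocircuitP M D :
  reflect [/\ D \subset ground M, rank M (ground M :\: D) < rank M (ground M)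
    & {in D, forall e, rank M (e |: (ground M :\: D)) = rank M (ground M)}]
  (cocircuit M D).
Proof.
have cI X e : X \subset ground M -> e \in X ->
    ground M :\: (X :\ e) = e |: (ground M :\: X).
  move=> sX eX; apply/setP=> x; rewrite !inE.
  by case: eqP => //= ->; rewrite (subsetP sX) // .
have rD := @rank_dual M.
apply: (iffP (circuitP _ _)) => /= [[sD r1 r2]|[sD r1 r2]].
  have E := rD D sD; split=> //; first lia.
  move=> e eD; have := rD (D :\ e) (subset_trans (subD1set _ _) sD).
  by rewrite cI // r2 //; have := cardsD1 e D; rewrite eD; lia.
have E := rD D sD.
have dE e : e \in D -> rank (dual_matroid M) (D :\ e) = #|D :\ e|.
  move=> eD; have := rD (D :\ e) (subset_trans (subD1set _ _) sD).
  by rewrite cI // r2 //; lia.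
have [e eD] : exists e, e \in D.
  by apply/set0Pn; apply: contraTneq r1 => ->; rewrite setD0 ltnn.
have rE : (rank (dual_matroid M) D).+1 = #|D|.
  have := rankS (dual_matroid M) (subD1set D e); have := dE e eD.
  by have := cardsD1 e D; rewrite eD; lia.
split=> // f fD; rewrite dE //; have := cardsD1 f D; rewrite fD; lia.
Qed.

End MinorRank.

(** * Cyclic intervals and separation in a linear order *)

Section CyclicOrder.

Variables (T : finType) (le : rel T).
Implicit Types (A C E F K S : {set T}) (a b c d : T).

Lemma cyclic_intervalC E A :
  cyclic_interval E le A -> cyclic_interval E le (E :\: A).
Proof.
case=> sA iA; split; first exact: subsetDl.
by rewrite setDDr setDv set0U (setIidPr sA); case: iA; [right | left].
Qed.

Lemma is_interval_sub E E' A :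
  is_interval E le A -> E' \subset E -> is_interval E' le (A :&: E').
Proof.
case=> sA iA sE; split; first exact: subsetIr.
move=> a b c /setIP[aA _] /setIP[bA _] cE' ac cb; rewrite inE cE' andbT.
exact: iA aA bA (subsetP sE c cE') ac cb.
Qed.

Lemma cyclic_interval_sub E E' A :
  cyclic_interval E le A -> E' \subset E -> cyclic_interval E' le (A :&: E').
Proof.
case=> sA iA sE; split; first exact: subsetIr.
have -> : E' :\: (A :&: E') = (E :\: A) :&: E'.
  apply/setP=> x; rewrite !inE; have := subsetP sE x.
  by case: (x \in E') => [->|]; rewrite ?andbT ?andbF.
by case: iA => /is_interval_sub/(_ sE); [left | right].
Qed.

(** The points alternate as [a], [c], [b], [d]. If [C] is an interval, [b] between [c] and [d]
    violates it; if its complement is one, [c] between [a] and [b] does. *)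
Lemma cyclic_interval_cross E C a b c d : cyclic_interval E le C ->
  a \in E :\: C -> b \in E :\: C -> c \in C -> d \in C ->
  le a c -> le c b -> le b d -> False.
Proof.
case=> sC [] [_ iC] aE bE cC dC ac cb bd.
  have [bE' bC] := setDP bE.
  by case/negP: bC; apply: iC cC dC bE' cb bd.
by have := iC a b c aE bE (subsetP sC c cC) ac cb; rewrite inE cC.
Qed.

Definition hull E S : {set T} :=
  [set x in E | [exists a in S, exists b in S, le a x && le x b]].

Lemma hullP E S x :
  reflect (x \in E /\ exists a b, [/\ a \in S, b \in S, le a x & le x b])
          (x \in hull E S).
Proof.
rewrite inE; apply: (iffP andP) => [[xE /existsP[a /andP[aS]]]|[xE [a [b]]]].
  by case/existsP=> b /and3P[bS ax xb]; split=> //; exists a, b.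
case=> aS bS ax xb; split=> //; apply/existsP; exists a; rewrite aS.
by apply/existsP; exists b; rewrite bS ax.
Qed.

Lemma hull_interval E S : linear_order_on E le -> S \subset E ->
  is_interval E le (hull E S).
Proof.
move=> [_ _ tr _] sS; split; first by apply/subsetP=> x /hullP[].
move=> a b c /hullP[aE [a1 [_ [a1S _ a1a _]]]].
move=> /hullP[bE [_ [b2 [_ b2S _ bb2]]]].
move=> cE ac cb; apply/hullP; split=> //; exists a1, b2; split=> //.
  by apply: tr a1a ac => //; apply: (subsetP sS).
by apply: tr cb bb2 => //; apply: (subsetP sS).
Qed.

Lemma hull_sub E S : linear_order_on E le -> S \subset E -> S \subset hull E S.
Proof.
move=> [re _ _ _] sS; apply/subsetP=> x xS; have xE := subsetP sS x xS.
by apply/hullP; split=> //; exists x, x; split=> //; apply: re.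
Qed.

(** If the hull of [K] avoids [F], it is the required set. Otherwise some element of [F] lies
    between two elements of [K]; without crossings no element of [K] then lies in the hull of [F],
    whose complement serves. *)
Lemma cyclic_interval_separation E F K : linear_order_on E le ->
  F \subset E -> K \subset E -> [disjoint K & F] ->
  (forall f1 f2 k1 k2, f1 \in F -> f2 \in F -> f1 != f2 ->
     k1 \in K -> k2 \in K -> k1 != k2 ->
     cyclic_interval ([set f1; f2] :|: [set k1; k2]) le [set f1; f2]) ->
  exists A, [/\ cyclic_interval E le A, K \subset A & [disjoint A & F]].
Proof.
move=> lo sF sK dKF cyc; have [_ anti _ tot] := lo.
have FE := subsetP sF; have KE := subsetP sK.
have kf k f : k \in K -> f \in F -> k != f.
  by move=> kK; apply: contraTneq => <-; rewrite (disjointFr dKF).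
(* Antisymmetry yields the distinctness of the two outer points in a chain, which the hypothesis on
   four points requires. *)
have neq x y z : x \in E -> y \in E -> z \in E -> x != y ->
    le x y -> le y z -> x != z.
  move=> xE yE zE nxy xy yz; apply: contraNneq nxy => xz.
  by apply/eqP; apply: anti => //; rewrite xy xz yz.
have cyc4 f1 f2 k1 k2 : f1 \in F -> f2 \in F -> f1 != f2 ->
     k1 \in K -> k2 \in K -> k1 != k2 ->
  [/\ cyclic_interval ([set f1; f2] :|: [set k1; k2]) le [set f1; f2],
      k1 \in ([set f1; f2] :|: [set k1; k2]) :\: [set f1; f2] &
      k2 \in ([set f1; f2] :|: [set k1; k2]) :\: [set f1; f2]].
  move=> f1F f2F f12 k1K k2K k12; split; first exact: cyc.
    by rewrite !inE !eqxx !orbT /= andbT negb_or !kf.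
  by rewrite !inE !eqxx !orbT /= andbT negb_or !kf.
have kfkf k1 f1 k2 f2 : k1 \in K -> f1 \in F -> k2 \in K -> f2 \in F ->
    le k1 f1 -> le f1 k2 -> le k2 f2 -> False.
  move=> k1K f1F k2K f2F l1 l2 l3.
  have [||c4 k1D k2D] := @cyc4 f1 f2 k1 k2 f1F f2F _ k1K k2K _.
  - by apply: neq (FE _ f1F) (KE _ k2K) (FE _ f2F) _ l2 l3; rewrite eq_sym kf.
  - by apply: neq (KE _ k1K) (FE _ f1F) (KE _ k2K) _ l1 l2; rewrite kf.
  exact: cyclic_interval_cross c4 k1D k2D (set21 _ _) (set22 _ _) l1 l2 l3.
(* The alternation starting in [F] is excluded by passing to the complementary pair of the four
   points. *)
have fkfk f1 k1 f2 k2 : k1 \in K -> f1 \in F -> k2 \in K -> f2 \in F ->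
    le f1 k1 -> le k1 f2 -> le f2 k2 -> False.
  move=> k1K f1F k2K f2F l1 l2 l3.
  have [||c4 k1D k2D] := @cyc4 f1 f2 k1 k2 f1F f2F _ k1K k2K _.
  - by apply: neq (FE _ f1F) (KE _ k1K) (FE _ f2F) _ l1 l2; rewrite eq_sym kf.
  - by apply: neq (KE _ k1K) (FE _ f2F) (KE _ k2K) _ l2 l3; rewrite kf.
  apply: (cyclic_interval_cross (cyclic_intervalC c4) _ _ k1D k2D l1 l2 l3).
    by rewrite !inE !eqxx.
  by rewrite !inE !eqxx !orbT.
have [/existsP[f /andP[fF fh]]|noF] := boolP [exists f in F, f \in hull E K].
  exists (E :\: hull E F); split.
  - apply: cyclic_intervalC; split; last by left; apply: hull_interval.
    by apply/subsetP=> x /hullP[].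
  - have [fE [k1 [k2 [k1K k2K k1f fk2]]]] := hullP _ _ _ fh.
    apply/subsetP=> k kK; rewrite inE (subsetP sK) // andbT.
    apply/negP=> /hullP[kE [f1 [f2 [f1F f2F f1k kf2]]]].
    (* The position of [k] relative to [f] decides which alternation arises: [k1], [f], [k], [f2] or
       [f1], [k], [f], [k2]. *)
    have [fk|kf'] := orP (tot f k fE kE).
      exact: kfkf k1K fF kK f2F k1f fk kf2.
    exact: fkfk kK f1F k2K fF f1k kf' fk2.
  rewrite -setI_eq0 -subset0; apply/subsetP=> x /setIP[/setDP[_ +] xF].
  by rewrite (subsetP (hull_sub lo sF)).
exists (hull E K); split.
- split; last by left; apply: hull_interval.
  by apply/subsetP=> x /hullP[].
- exact: hull_sub.
rewrite -setI_eq0 -subset0; apply/subsetP=> x /setIP[xh xF].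
by case/negP: noF; apply/existsP; exists x; rewrite xF.
Qed.

End CyclicOrder.

(** * The four-element minor *)

Section Crossing.

Variables (T : finType) (M : matroid T).
Implicit Types (C D F J S W X Y Z : {set T}) (e f k : T).

(** A basis [J] of [F] containing [C :\ f1] makes [f1] and [f2] interchangeable: each completes
    [J :\ f2] to a spanning set of [F]. Contract [J :\ f2] together with [D] minus [k1] and [k2],
    and delete the other elements. Then [f1] and [f2] become parallel, and the remaining ranks come
    from those of subsets of [D] in the contraction of [F]. *)
Lemma connected_minor_pair F C D f1 f2 k1 k2 : F \subset ground M ->
  circuit M C -> C \subset F -> f1 \in C -> f2 \in C -> f1 != f2 ->
  circuit (contract M F) D -> k1 \in D -> k2 \in D -> k1 != k2 ->
  exists N, [/\ minor N M, ground N = [set f1; f2] :|: [set k1; k2],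
                circuit N [set f1; f2] & cocircuit N [set k1; k2]].
Proof.
move=> sF cC sCF f1C f2C f12 cD k1D k2D k12.
have [/subsetP sC rC rCe] := circuitP _ _ cC.
have [sD rD rDe] := circuitP _ _ cD; rewrite ground_contract in sD.
have iC1 : C :\ f1 \in indeps M.
  by rewrite indep_rank rCe // -eqSS rC (cardsD1 f1 C) f1C.
have [J [iJ sCJ sJF cJ]] := rank_basis iC1 (subset_trans (subD1set C f1) sCF).
have f2J : f2 \in J by rewrite (subsetP sCJ) // !inE eq_sym f12.
have f1J : f1 \notin J.
  apply: contra (circuit_dep cC) => f1J; apply: indepsS iJ.
  by rewrite -(setD1K f1C) subUset sub1set f1J.
have f1F := subsetP sCF f1 f1C; have f2F := subsetP sCF f2 f2C.
have DF k : k \in D -> k \notin F.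
  by move=> kD; have := subsetP sD k kD; rewrite inE; case/andP.
have DE k : k \in D -> k \in ground M.
  by move=> kD; have := subsetP sD k kD; rewrite inE; case/andP.
pose L := D :\ k1 :\ k2; pose Z := (J :\ f2) :|: L.
have LD k : k \in L -> k \in D by rewrite !inE => /and3P[].
(* The set [f1 |: (J :\ f2)] contains [C :\ f2], so it spans [f2] and hence all of [J]. *)
have rJ1 : rank M (f1 |: (J :\ f2)) = rank M F.
  apply/eqP; rewrite eqn_leq rankS /=; last first.
    by rewrite subUset sub1set f1F (subset_trans (subD1set _ _)).
  rewrite -(circuit_cl cC f2C (X := f1 |: (J :\ f2))); last first.
    apply/subsetP=> x; rewrite !inE => /andP[xf2 xC]; rewrite xf2 /=.
    by case: eqP => //= /eqP xf1; rewrite (subsetP sCJ) // !inE xf1.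
  by rewrite -cJ; apply: leq_rank => //; rewrite setUCA setD1K // subsetUr.
have rJ2 : rank M (f2 |: (J :\ f2)) = rank M F.
  by rewrite setD1K // -cJ; apply/eqP; rewrite -indep_rank.
(* As soon as [W] supplies [f1] or [f2], the set [W :|: Z] spans [F]. Every rank needed below,
   except that of [Z] itself, is an instance with [S] a subset of [[set k1; k2]]. *)
have rW W S : W \subset F -> (f1 \in W) || (f2 \in W) ->
    rank M (W :|: S :|: Z) = rank M (F :|: (L :|: S)).
  move=> sWF inW; apply/eqP; rewrite eqn_leq; apply/andP; split.
    rewrite /Z; apply: rankS; rewrite !subUset (subset_trans sWF) ?subsetUl //.
    rewrite (subset_trans (subD1set _ _)) ?(subset_trans sJF) ?subsetUl //.
    by rewrite setUA subsetUr -setUA setUCA subsetUl.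
  have [f [fW fF rf]] : exists f, [/\ f \in W, f \in F
      & rank M (f |: (J :\ f2)) = rank M F].
    by case/orP: inW => ?; [exists f1 | exists f2].
  rewrite -(rank_spanU _ _ rf); last first.
    by rewrite subUset sub1set fF (subset_trans (subD1set _ _)).
  apply: rankS; rewrite /Z; apply/subsetP=> x; rewrite !inE.
  by case: eqP => [->|_] /=; rewrite ?fW //; case: (x \in S);
    rewrite ?orbT ?orbF //= => ->; rewrite orbT.
have rc S : S \subset D -> rank (contract M F) S + rank M F = rank M (S :|: F).
  by move=> sS; apply: rank_contract => //; apply: subset_trans sS sD.
have k2D1 : k2 \in D :\ k1 by rewrite !inE eq_sym k12.
have cL : #|L|.+2 = #|D|
  by rewrite (cardsD1 k1 D) k1D (cardsD1 k2 (D :\ k1)) k2D1.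
have cJ2 : #|J :\ f2|.+1 = #|J| by rewrite (cardsD1 f2 J) f2J.
have cZ : #|Z| <= #|J :\ f2| + #|L| by rewrite /Z cardsU leq_subr.
have sLD : L \subset D by apply/subsetP=> x /LD.
have rFL : rank M (F :|: (L :|: set0)) <= #|J| + #|L|.
  by rewrite setU0 cJ rankU_leq.
have rD' : rank (contract M F) D = #|L|.+1 by apply: succn_inj; rewrite rD cL.
have rFD (k : T) : k \in D -> rank M (F :|: (D :\ k)) = (#|J| + #|L|).+1.
  by move=> kD; rewrite setUC -rc ?subD1set // rDe // rD' -cJ addSn addnC.
have L1 : L :|: [set k1] = D :\ k2.
  apply/setP=> x; rewrite !inE; have [->|] := eqVneq x k1.
    by rewrite orbT k12 k1D.
  by rewrite orbF.
have L2 : L :|: [set k2] = D :\ k1.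
  by rewrite setUC setD1K.
have L12 : L :|: [set k1; k2] = D.
  by rewrite setUCA L2 setD1K.
have r0 W : W \subset F -> (f1 \in W) || (f2 \in W) ->
    rank M (W :|: Z) = rank M (F :|: L).
  by move=> sW fW; have := rW W set0 sW fW; rewrite !setU0.
have r1 W : W \subset F -> (f1 \in W) || (f2 \in W) ->
    rank M (W :|: [set k1] :|: Z) = (#|J| + #|L|).+1.
  by move=> sW fW; rewrite rW // L1 rFD.
have r2 W : W \subset F -> (f1 \in W) || (f2 \in W) ->
    rank M (W :|: [set k2] :|: Z) = (#|J| + #|L|).+1.
  by move=> sW fW; rewrite rW // L2 rFD.
have r12 W : W \subset F -> (f1 \in W) || (f2 \in W) ->
    rank M (W :|: [set k1; k2] :|: Z) = (#|J| + #|L|).+1.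
  by move=> sW fW; rewrite rW // L12 setUC -rc // rD' -cJ addSn addnC.
have rFL' : rank M (F :|: L) = #|J| + #|L|.
  rewrite setU0 in rFL; apply/eqP; rewrite eqn_leq rFL /= -ltnS -(rFD _ k2D).
  by rewrite -L1 setUA setUC rankU1_leq.
(* The size of [Z] bounds its rank above; adding the single element [f1] reaches the rank of
   [F :|: L], which bounds it below. *)
have rZ : (rank M Z).+1 = #|J| + #|L|.
  have := leq_trans (rank_leq_card M Z) cZ; have := rankU1_leq M f1 Z.
  by rewrite r0 ?sub1set // ?set11 // rFL'; move: cJ2; clear; lia.
pose E4 := [set f1; f2] :|: [set k1; k2].
have sE4 : E4 \subset ground M.
  by rewrite !subUset !sub1set (DE _ k1D) (DE _ k2D) !(subsetP sF).
have sZ : Z \subset ground M.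
  rewrite subUset (subset_trans (subD1set _ _)) ?(subset_trans sJF) //=.
  by apply/subsetP=> x /LD /DE.
have dZ : [disjoint E4 & Z].
  rewrite -setI_eq0 -subset0; apply/subsetP=> x; rewrite !inE.
  case/andP=> /orP[/orP[]|/orP[]] /eqP->.
  - by rewrite (negPf f1J) andbF /= => /and3P[_ _ /DF]; rewrite f1F.
  - by rewrite eqxx /= => /and3P[_ _ /DF]; rewrite f2F.
  - rewrite eqxx andbF orbF => /andP[_ /(subsetP sJF)].
    by rewrite (negPf (DF _ k1D)).
  rewrite eqxx orbF => /andP[_ /(subsetP sJF)].
  by rewrite (negPf (DF _ k2D)).
pose X := ground M :\: (E4 :|: Z).
pose N := contract (delete M X) Z.
have gX : ground M :\: (X :|: Z) = E4.
  rewrite -setDDl setDDr setDv set0U setIUr (setIidPr sE4) (setIidPr sZ).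
  by rewrite setDUl setDv setU0; apply/setDidPl.
have dXZ : [disjoint X & Z].
  by rewrite -setI_eq0 setIDAC -setIDA setDUr setDv setI0 setI0.
have gN : ground N = E4 by rewrite ground_minor gX.
have rN S : S \subset E4 -> rank N S + rank M Z = rank M (S :|: Z).
  by move=> sS; apply: rank_minor => //; rewrite gX.
have sfE : [set f1; f2] \subset E4 by apply: subsetUl.
have sfF : [set f1; f2] \subset F by rewrite subUset !sub1set f1F.
have in1 : (f1 \in [set f1; f2]) || (f2 \in [set f1; f2]) by rewrite set21.
have rf : rank N [set f1; f2] = 1.
  by have := rN _ sfE; rewrite r0 // rFL' -rZ; clear; lia.
exists N; split => //.
- by exists X, Z; split=> //; apply: subsetDl.
- apply/circuitP; rewrite gN; split=> //.
    by rewrite rf cards2 f12.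
  move=> e /set2P[] ->; rewrite rf.
    have -> : [set f1; f2] :\ f1 = [set f2] by rewrite setU1K // inE.
    have := rN [set f2]; rewrite sub1set (subsetP sfE) ?set22 // => /(_ isT).
    by rewrite r0 ?sub1set ?set11 ?orbT // rFL' -rZ; clear; lia.
  have -> : [set f1; f2] :\ f2 = [set f1] by rewrite setUC setU1K // inE eq_sym.
  have := rN [set f1]; rewrite sub1set (subsetP sfE) ?set21 // => /(_ isT).
  by rewrite r0 ?sub1set ?set11 // rFL' -rZ; clear; lia.
have dk : E4 :\: [set k1; k2] = [set f1; f2].
  rewrite setDUl setDv setU0; apply/setDidPl.
  rewrite -setI_eq0 -subset0; apply/subsetP=> x; rewrite !inE.
  by case/andP=> /orP[] /eqP -> /orP[] /eqP e; move: (DF _ k1D) (DF _ k2D);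
    rewrite -e ?f1F ?f2F.
have rE : rank N E4 = 2.
  by have := rN _ (subxx _); rewrite r12 // -rZ; clear; lia.
apply/cocircuitP; rewrite gN; split; first exact: subsetUr.
  by rewrite dk rf rE.
rewrite dk rE => e ek; have se : e |: [set f1; f2] \subset E4.
  by rewrite subUset sub1set sfE inE ek orbT.
have := rN _ se; rewrite (setUC [set e]).
by case/set2P: ek => ->; rewrite ?r1 ?r2 // -rZ; clear; lia.
Qed.

End Crossing.

(** * Components of a flat, and lifting circuits from minors *)

Section Components.

Variables (T : finType) (M : matroid T).
Implicit Types (C D F H K X Y : {set T}) (e f x : T).

Lemma component_circuit K e f : component M K -> e \in K -> f \in K -> e != f ->
  exists C, [/\ circuit M C, e \in C & f \in C].
Proof.
case=> x _ ->; rewrite !inE => /andP[_ xe] /andP[_ xf] ef.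
apply: same_componentP ef _; apply: same_component_trans xf.
by rewrite same_component_sym.
Qed.

Definition restrict_component H x : {set T} :=
  [set f in H | same_component (restrict M H) x f].

Lemma circuit_restrict_component H x C e : circuit M C -> C \subset H ->
  e \in C -> e \in restrict_component H x -> C \subset restrict_component H x.
Proof.
move=> cC sC eC; rewrite inE => /andP[_ xe]; apply/subsetP=> f fC.
rewrite inE (subsetP sC) //=; apply: same_component_trans xe _.
by apply: (@circuit_same_component _ _ C); rewrite // circuit_restrict sC.
Qed.

(** A circuit inside [H] that meets the component lies wholly in it, so the circuits witnessing
    connectivity survive the smaller restriction. *)
Lemma connected_restrict_component H x :
  connected_set M (restrict_component H x).
Proof.
move=> e f /setIP[_ eF] /setIP[_ fF]; have [->|ef] := eqVneq e f.
  exact: same_component_refl.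
move: (eF) fF; rewrite !inE => /andP[_ xe] /andP[_ xf].
have /(same_componentP ef)[C [+ eC fC]] : same_component (restrict M H) e f.
  by apply: same_component_trans xf; rewrite same_component_sym.
rewrite circuit_restrict => /andP[sC cC].
apply: (circuit_same_component _ eC fC); rewrite circuit_restrict cC andbT.
exact: circuit_restrict_component cC sC eC eF.
Qed.

(** An element [e] spanned by the component lies in the flat [H] and on a circuit inside [e |: F].
    As [e] is not a loop, this circuit meets [F], and so [e] belongs to the same component. *)
Lemma flat_restrict_component H x : loopless M -> flat M H ->
  flat M (restrict_component H x).
Proof.
move=> nl /andP[sH /eqP clH]; set F := restrict_component H x.
have sFH : F \subset H by apply/subsetP=> f; rewrite inE => /andP[].
have sF := subset_trans sFH sH.
rewrite /flat sF eqEsubset sub_cl // andbT; apply/subsetP=> e.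
rewrite in_cl => /andP[eE /eqP re]; apply/negPn/negP=> eF.
have [C [cC eC sC]] := circuit_through eE eF re.
have eH : e \in H.
  have := rank_spanU H (subsetUr [set e] F) (esym re).
  rewrite -setUA (setUidPr sFH) => rH; rewrite -clH in_cl eE rH /=.
  exact: eqxx.
have sCH : C \subset H.
  by apply: subset_trans sC _; rewrite subUset sub1set eH.
have [f fC fe] : exists2 f, f \in C & f != e.
  apply/exists_inP; apply: contraNT (nl e) => /exists_inPn nf.
  rewrite /loop; suff -> : [set e] = C by [].
  apply/eqP; rewrite eqEsubset sub1set eC; apply/subsetP=> f /nf.
  by rewrite negbK inE.
have fF : f \in F.
  by have := subsetP sC f fC; rewrite in_setU1 (negPf fe).
by case/negP: eF; apply: subsetP (circuit_restrict_component cC sCH fC fF) e eC.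
Qed.

Lemma flat_cl X : X \subset ground M -> flat M (cl M X).
Proof.
move=> sX; rewrite /flat cl_ground eqEsubset sub_cl ?cl_ground // andbT.
apply/subsetP=> e; rewrite !in_cl => /andP[-> /=].
rewrite setUC rank_clU // -[cl M X]setU0 rank_clU // setU0.
by rewrite setUC.
Qed.

Lemma rank_cl X : X \subset ground M -> rank M (cl M X) = rank M X.
Proof. by move=> sX; rewrite -[cl M X]setU0 rank_clU // setU0. Qed.

(** The rank hypotheses say that [X] is a circuit once [Y] is contracted. Replace [Y] by a basis
    [J]: then [X :|: J] is dependent, while removing any [e] of [X] makes it independent, so a
    circuit in it contains all of [X]. *)
Lemma minor_circuit Y X : Y \subset ground M -> X \subset ground M ->
  [disjoint X & Y] -> (rank M (X :|: Y)).+1 = rank M Y + #|X| ->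
  {in X, forall e, rank M ((X :\ e) :|: Y) = rank M (X :|: Y)} ->
  exists C, [/\ circuit M C, X \subset C & C \subset X :|: Y].
Proof.
move=> sY sX dXY rX rXe; have [J [iJ sJY cJ]] := rank_witness M Y.
have rJ : rank M J = rank M Y by apply/eqP; rewrite -cJ -indep_rank.
have rS S : rank M (S :|: J) = rank M (S :|: Y).
  by rewrite !(setUC S); apply: rank_spanU.
have cS (S : {set T}) : S \subset X -> #|S :|: J| = #|S| + rank M Y.
  move=> sS; rewrite cardsU -cJ (_ : S :&: J = set0) ?cards0 ?subn0 //.
  by apply/eqP; rewrite setI_eq0; apply: disjointW sS sJY dXY.
have [||C cC sC] := @dep_circuit _ M (X :|: J).
- by rewrite subUset sX (subset_trans sJY).
- rewrite indep_rank rS cS // neq_ltn; apply/orP; left.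
  by rewrite -ltnS rX addnC.
exists C; split=> //; last by apply: subset_trans sC _; rewrite setUS.
apply/subsetP=> e eX; apply: contraNT (circuit_dep cC) => eC.
have : (X :\ e) :|: J \in indeps M.
  rewrite indep_rank rS rXe // cS ?subD1set // -eqSS rX addnC.
  by rewrite (cardsD1 e X) eX.
apply: indepsS; apply/subsetP=> f fC; have := subsetP sC f fC.
by rewrite !inE; case: eqP => // fe; rewrite -fe fC in eC.
Qed.

End Components.

(** * The implications between the three statements *)

Section Equivalence.

Variables (T : finType) (M : matroid T) (le : rel T).
Implicit Types (C D F H K X Y : {set T}) (e f x : T).

Lemma cyclic_interval_property_hyperplane (N : matroid T) X :
  loopless M -> cyclic_interval_property M le ->
  minor N M -> loopless N -> coloopless N -> circuit_hyperplane N X ->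
  cyclic_interval (ground N) le X.
Proof.
move=> nlM P1 [U [Y [sU sY dUY defN]]] nlN ncN.
case/andP=> /circuitP[sX rX rXe] /andP[/andP[_ /eqP clX] /eqP rE].
have gN : ground N = ground M :\: (U :|: Y) by rewrite defN ground_minor.
have rN (Z : {set T}) : Z \subset ground N ->
    rank N Z + rank M Y = rank M (Z :|: Y).
  by move=> sZ; rewrite defN; apply: rank_minor => //; rewrite -gN.
have sNE : ground N \subset ground M by rewrite gN subsetDl.
have sXE := subset_trans sX sNE.
have dNY : [disjoint ground N & Y].
  by rewrite gN -setI_eq0 setIDAC -setIDA setDUr setDv setI0 setI0.
have sXY : X :|: Y \subset ground M by rewrite subUset sXE.
have [||C [cC sXC sCXY]] := minor_circuit sY sXE (disjointWl sX dNY).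
- by rewrite -(rN X) // -addSn rX addnC.
- move=> e eX; rewrite -(rN X) // -(rXe e eX) rN //.
  exact: subset_trans (subD1set _ _) sX.
have [x xX] : exists x, x \in X by apply/card_gt0P; rewrite -rX.
pose H := cl M (X :|: Y); pose F := restrict_component M H x.
have flatH : flat M H by apply: flat_cl.
have sH : H \subset ground M by apply: cl_ground.
have sCH : C \subset H by apply: subset_trans sCXY (sub_cl sXY).
have sFH : F \subset H by apply/subsetP=> f; rewrite inE => /andP[].
have sF := subset_trans sFH sH.
have sXF : X \subset F.
  apply: (subset_trans sXC).
  apply: (circuit_restrict_component cC sCH (subsetP sXC x xX)).
  by rewrite inE same_component_refl (subsetP sCH) // (subsetP sXC).
(* A one-element circuit [X] would be a loop of [N]. The bound passes to [F], as the cyclic interval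
   property demands. *)
have X2 : 2 <= #|X|.
  rewrite ltnNge; apply/negP => X1; case/negP: (nlN x).
  rewrite /loop; have -> : [set x] = X.
    by apply/eqP; rewrite eqEcard sub1set xX cards1 X1.
  by apply/circuitP.
pose D := ground N :\: X.
(* As [X] is a flat of [N], adding [d] raises its rank in [N], hence that of [X :|: Y] in [M]. *)
have rHd d : d \in D -> rank M (d |: H) = (rank M H).+1.
  case/setDP=> dN dX; have := dX; rewrite -clX in_cl dN /= => rd.
  apply/eqP; rewrite eqn_leq rankU1_leq /= rank_cl //.
  rewrite (setUC [set d]) rank_clU //.
  rewrite -(rN X) // -addSn.
  have -> : X :|: Y :|: [set d] = d |: X :|: Y by rewrite setUC setUA.
  rewrite -rN; last by rewrite subUset sub1set dN.
  by rewrite leq_add2r ltn_neqAle eq_sym rd rankS ?subsetUr.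
have dDH d : d \in D -> d \notin H.
  move=> /rHd rd; apply/negP=> dH; move: rd.
  by rewrite (setUidPr _) ?sub1set // => /n_Sn.
(* The upper bound holds because [N] has rank only one more than its hyperplane [X]. *)
have rHD d e : d \in D -> e \in D -> rank M (e |: (d |: H)) = (rank M H).+1.
  move=> dD eD; apply/eqP; rewrite eqn_leq; apply/andP; split; last first.
    by rewrite -(rHd d dD) rankS ?subsetUr.
  have -> : e |: (d |: H) = H :|: [set e; d] by rewrite setUA setUC.
  rewrite rank_clU // rank_cl // -(rN X) // -addSn rE rN //; apply: rankS.
  rewrite -setUA (setUC Y) setUA setSU // !subUset !sub1set sX.
  by case/setDP: dD => ->; case/setDP: eD => ->.
have [d dD] : exists d, d \in D.
  apply/set0Pn; by rewrite setD_eq0; apply/negP=> /(rankS N); rewrite -rE ltnn.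
(* If [D] were a single element, that element would be a coloop of [N], since the complement [X] is
   a hyperplane. *)
have D2 : 2 <= #|D|.
  rewrite ltnNge; apply/negP => D1; case/negP: (ncN d).
  have eD : [set d] = D by apply/eqP; rewrite eqEcard sub1set dD cards1 D1.
  have NX : ground N :\: [set d] = X.
    by rewrite eD setDDr setDv set0U; apply/setIidPr.
  apply/cocircuitP; rewrite NX -rE ltnSn; split=> //.
    by rewrite eD subsetDl.
  by move=> e /set1P ->; rewrite -NX setD1K ?NX -?rE //; case/setDP: dD.
have dE e : e \in D -> e \in ground M :\: F.
  move=> eD; rewrite inE (contra (subsetP sFH e) (dDH e eD)).
  by case/setDP: eD => /(subsetP sNE).
pose K := [set e in ground (contract M F) | same_component (contract M F) d e].
(* In the contraction of [F], the set [H :\: F] plays the role of [S] in [rank_same_component]: [d]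
   and [e] each raise its rank by one, and so do both together. *)
have sDK : D \subset K.
  apply/subsetP=> e eD; rewrite inE ground_contract dE //=.
  have rc (S : {set T}) : S \subset ground M :\: F ->
    rank (contract M F) S + rank M F = rank M (S :|: F) by apply: rank_contract.
  have sHF : H :\: F \subset ground M :\: F by apply: setSD.
  have HF : H :\: F :|: F = H by rewrite setUC -{1}(setIidPr sFH) setID.
  have r0 := rc _ sHF.
  have rd a : a \in D -> (rank (contract M F) (H :\: F)).+1 =
      rank (contract M F) (a |: (H :\: F)).
    move=> aD; apply: (@addIn (rank M F)).
    by rewrite addSn r0 rc ?subUset ?sub1set ?dE // -setUA HF rHd.
  apply: (@rank_same_component _ _ d e (H :\: F));
    rewrite ?ground_contract ?dE -?rd //.
  apply: (@addIn (rank M F)).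
  rewrite rc ?subUset ?sub1set ?dE // -!setUA HF rHD //.
  by rewrite addSn r0 HF.
have [||||||A [cA sKA dAF]] := P1 F _ _ _ _ K.
- exact: flat_restrict_component.
- exact: connected_restrict_component.
- apply/properP; split=> //; exists d; first by case/setDP: (dE _ dD).
  by case/setDP: (dE _ dD).
- exact: leq_trans X2 (subset_leq_card sXF).
- by exists d; rewrite // ground_contract dE.
- by apply: leq_trans D2 _; apply: subset_leq_card.
(* Since [A] contains [D] and avoids [F], hence [X], its trace on [ground N] is exactly [D], and the
   complement of that trace is [X]. *)
have := cyclic_intervalC (cyclic_interval_sub cA sNE).
have -> : A :&: ground N = D.
  apply/setP=> e; have [eD|] := boolP (e \in D).
    by rewrite inE (subsetP sKA) ?(subsetP sDK) //; case/setDP: eD.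
  rewrite !inE; case: (e \in ground N); rewrite ?andbF // !andbT negbK.
  by move=> /(subsetP sXF) eF; rewrite (disjointFl dAF).
by rewrite setDDr setDv set0U (setIidPr sX).
Qed.

(** Here [C] has rank 1 and any element of [D] raises this to the full rank 2, so [C] is a
    hyperplane and [D] has no loop. An element of [C] is spanned by the other one, so it is not a
    coloop. Minimality of [C] and [D] excludes loops in [C] and coloops in [D]. *)
Lemma pair_circuit_hyperplane (N : matroid T) C D : ground N = C :|: D ->
  [disjoint C & D] -> circuit N C -> #|C| = 2 -> cocircuit N D -> #|D| = 2 ->
  [/\ loopless N, coloopless N & circuit_hyperplane N C].
Proof.
move=> gN dCD cC C2 cD D2.
have [sC rC rCe] := circuitP _ _ cC; have [sD rD rDe] := cocircuitP _ _ cD.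
have ED : ground N :\: D = C.
  by rewrite gN setDUl setDv setU0; apply/setDidPl.
rewrite ED in rD rDe.
have rE : rank N (ground N) = 2.
  have [e eD] : exists e, e \in D by apply/card_gt0P; rewrite D2.
  by have := rankU1_leq N e C; rewrite rDe //; lia.
have neq1 (S : {set T}) e : #|S| = 2 -> [set e] = S -> False.
  by move=> S2 E; move: S2; rewrite -E cards1.
split.
- move=> e; apply/negP=> le0; have [/= + _ _] := circuitP _ _ le0.
  rewrite sub1set {1}gN => /setUP[eC|eD].
    by apply: (neq1 _ e C2); apply: circuit_sub le0 cC _; rewrite sub1set.
  have r0 : rank N [set e] = 0.
    by have [_ r0 _] := circuitP _ _ le0; rewrite cards1 in r0; case: r0.
  have := rank_submod N [set e] C; rewrite r0 add0n rDe //.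
  by move=> /(leq_trans (leq_addr _ _)); rewrite leqNgt rD.
- move=> e; apply/negP=> cle; have [/= + re _] := cocircuitP _ _ cle.
  rewrite sub1set {1}gN => /setUP[eC|eD].
    move: re; rewrite -{2}(@setD1K _ e (ground N)) ?gN ?inE ?eC //.
    by rewrite (circuit_cl cC eC) ?ltnn // setSD ?subsetUl.
  by apply: (neq1 _ e D2); apply: circuit_sub cle cD _; rewrite sub1set.
rewrite /circuit_hyperplane cC /hyperplane rE; apply/andP; split=> //.
apply/andP; split; last by apply/eqP; lia.
rewrite /flat sC eqEsubset sub_cl // andbT; apply/subsetP=> e.
rewrite in_cl {1}gN => /andP[/setUP[//|eD]].
by rewrite rDe // => /eqP; lia.
Qed.

Lemma cyclic_interval_property_of_pairs : linear_order_on (ground M) le ->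
  (forall N : matroid T, minor N M ->
    forall C D : {set T}, ground N = C :|: D -> [disjoint C & D] ->
    circuit N C -> #|C| = 2 -> cocircuit N D -> #|D| = 2 ->
    cyclic_interval (ground N) le C) ->
  cyclic_interval_property M le.
Proof.
move=> lo P3 F /andP[sF _] conF _ _ K cK _.
have sK : K \subset ground M :\: F.
  by case: cK => e _ ->; rewrite -ground_contract; apply/subsetP=> x /setIdP[].
have [sKE dKF] : K \subset ground M /\ [disjoint K & F].
  by apply/andP; rewrite -subsetD.
(* Connectivity of [F] supplies a circuit through [f1] and [f2], and the component [K] one through
   [k1] and [k2]; the resulting minor has just these four elements, as the separation criterion
   needs. *)
apply: cyclic_interval_separation => // f1 f2 k1 k2 f1F f2F f12 k1K k2K k12.
have := conF f1 f2; rewrite !inE f1F f2F !(subsetP sF) // => /(_ isT isT).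
case/(same_componentP f12)=> C [+ f1C f2C]; rewrite circuit_restrict.
case/andP=> sCF cC; have [D [cD k1D k2D]] := component_circuit cK k1K k2K k12.
have [N [mN gN cN cocN]] :=
  connected_minor_pair sF cC sCF f1C f2C f12 cD k1D k2D k12.
rewrite -gN; apply: P3 mN _ _ gN _ cN _ cocN _; rewrite ?cards2 ?f12 ?k12 //.
rewrite disjoint_sym; apply: disjointW dKF;
  by rewrite subUset !sub1set ?f1F ?k1K.
Qed.

End Equivalence.

Theorem theorem3p6 (T : finType) (M : matroid T) (le : rel T)
    (HM : loopless M) (Hle : linear_order_on (ground M) le) :
  let P1 := cyclic_interval_property M le in
  let P2 := forall N : matroid T, minor N M -> loopless N -> coloopless N ->
    forall X : {set T}, circuit_hyperplane N X ->
    cyclic_interval (ground N) le X in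
  let P3 := forall N : matroid T, minor N M ->
    forall C D : {set T}, ground N = C :|: D -> [disjoint C & D] ->
    circuit N C -> #|C| = 2 -> cocircuit N D -> #|D| = 2 ->
    cyclic_interval (ground N) le C in
  (P1 <-> P2) /\ (P2 <-> P3).
Proof.
move=> P1 P2 P3.
have P12 : P1 -> P2.
  by move=> p1 N mN nl ncl X; apply: cyclic_interval_property_hyperplane.
have P23 : P2 -> P3.
  move=> p2 N mN C D gN dCD cC C2 cD D2.
  by have [nl ncl hC] := pair_circuit_hyperplane gN dCD cC C2 cD D2; apply: p2.
have P31 : P3 -> P1 by apply: cyclic_interval_property_of_pairs.
by split; split=> // p; [apply/P31/P23 | apply/P12/P31].
Qed.
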